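(* Let $S\subseteq\mathbb{R}^n$ be closed and let $\Phi\colon\mathbb{R}[X_1,\ldots,X_n]\to\mathbb{R}[X_1,\ldots,X_n]$ be an $\mathbb{R}$-linear map. Then the following are equivalent: (i) $\Phi$ is $S$-nonnegativity preserving. (ii) There is a measure $\mathfrak{m}\colon\mathcal{B}(S)\to\mathcal{F}(S)$, taking only nonnegative functions as its values, with $\Phi(p)=\int_S p\,d\mathfrak{m}$ for all $p\in\mathbb{R}[X_1,\ldots,X_n]$ in the following sense: for every polynomial $p$ and every sequence $(s_j)_j$ of real valued step functions on $S$ such that $|s_j|\le q$ on $S$ for some polynomial $q$ and all $j$, if $(s_j)_j$ converges pointwise on $S$ to $p$, then the sequence of functions $\left(\int_S s_j\,d\mathfrak{m}\right)_j$ converges pointwise on $S$ to $\Phi(p)$.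
   Context: A linear map $\Phi$ on $\mathbb{R}[X_1,\ldots,X_n]$ is called $S$-nonnegativity preserving if for every polynomial $p$ with $p\ge 0$ on $S$ one has $\Phi(p)\ge 0$ on $S$. $\mathcal{B}(S)$ is the $\sigma$-algebra of Borel subsets of $S$. $\mathcal{F}(S)$ is the real vector space of real valued, polynomially bounded functions on $S$ (functions $g\colon S\to\mathbb{R}$ with $|g|\le q$ on $S$ for some polynomial $q$). A measure $\mathfrak{m}\colon\mathcal{B}(S)\to\mathcal{F}(S)$ is a map with $\mathfrak{m}(\emptyset)=0$ and $\mathfrak{m}(\bigcup_i A_i)=\sum_i\mathfrak{m}(A_i)$, pointwise on $S$, for every countable family $(A_i)_i$ of pairwise disjoint Borel subsets of $S$. A step function is a function of the form $s=\sum_{i=1}^t r_i\mathds{1}_{A_i}$ with $r_i\in\mathbb{R}$ and pairwise disjoint $A_1,\ldots,A_t\in\mathcal{B}(S)$, where $\mathds{1}_{A}$ is the characteristic function of $A$; its integral is the function $\int_S s\,d\mathfrak{m}:=\sum_{i=1}^t r_i\,\mathfrak{m}(A_i)\in\mathcal{F}(S)$. *)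

(* Defs.v *)
From HB Require Import structures.
From mathcomp Require Import all_boot all_order all_algebra.
From mathcomp Require Import all_classical all_reals all_analysis.
(* The notations of mpoly clash with those of MathComp-Analysis, so only the
   constants are imported: [mpoly n R] is R[X_1, ..., X_n]. *)
From mathcomp Require Export -(notations) mpoly.

Set Implicit Arguments.
Unset Strict Implicit.
Unset Printing Implicit Defensive.

Import Order.TTheory GRing.Theory Num.Theory.
Import numFieldNormedType.Exports.

Local Open Scope classical_set_scope.
Local Open Scope ring_scope.

(* Functions on a subset S of R^n are represented by functions on R^n of which
   only the values on S are ever used. *)

Section Defs.
Variables (R : realType) (n : nat).
Implicit Types (S : set 'rV[R]_n) (m : set 'rV[R]_n -> 'rV[R]_n -> R).

Definition peval (p : mpoly n R) (x : 'rV[R]_n) : R :=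
  meval (fun i => x ord0 i) p.

Definition nonneg_preserving S (Phi : mpoly n R -> mpoly n R) : Prop :=
  forall p, (forall x, S x -> 0 <= peval p x) ->
    forall x, S x -> 0 <= peval (Phi p) x.

(* Generated inside S (complements are taken in S) by the relatively open
   subsets of S. *)
Definition borel S : set (set 'rV[R]_n) :=
  <<s S, [set U `&` S | U in open]>>.

Definition poly_bounded S (g : 'rV[R]_n -> R) : Prop :=
  exists q : mpoly n R, forall x, S x -> `|g x| <= peval q x.

(* Only the values [m A x] with A in B(S) and x in S matter; finite disjoint
   families are those that are eventually empty. *)
Definition function_measure S m : Prop :=
  [/\ forall A, borel S A -> poly_bounded S (m A),
      forall x, S x -> m set0 x = 0
    & forall A : nat -> set 'rV[R]_n,
        (forall i, borel S (A i)) -> trivIset setT A ->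
        forall x, S x ->
          \sum_(0 <= i < k) m (A i) x @[k --> \oo] --> m (\bigcup_i A i) x].

(* A representation sum_i r_i 1_{A_i} of a step function; the integral below
   does not depend on the representation since m is finitely additive. *)
Record step S := Step {
  step_size : nat;
  step_coef : 'I_step_size -> R;
  step_set : 'I_step_size -> set 'rV[R]_n;
  step_borel : forall i, borel S (step_set i);
  step_disjoint : trivIset setT step_set }.

Definition step_fun S (s : step S) (x : 'rV[R]_n) : R :=
  \sum_(i < step_size s) step_coef i * \1_(step_set i) x.

Definition step_integral S m (s : step S) (x : 'rV[R]_n) : R :=
  \sum_(i < step_size s) step_coef i * m (step_set i) x.

Definition represents S m (Phi : mpoly n R -> mpoly n R) : Prop :=
  forall (p : mpoly n R) (s : nat -> step S),
    (exists q : mpoly n R, forall j x, S x ->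
       `|step_fun (s j) x| <= peval q x) ->
    (forall x, S x -> step_fun (s j) x @[j --> \oo] --> peval p x) ->
    forall x, S x ->
      step_integral m (s j) x @[j --> \oo] --> peval (Phi p) x.

End Defs.

(* Main.v *)
(** For (ii) => (i), a polynomial that is nonnegative on S is a limit of
    nonnegative step functions below it.  For (i) => (ii), fix x in S; then
    L p := Phi(p)(x) is a linear functional that is nonnegative on the
    polynomials nonnegative on S, and Haviland's theorem represents it by a
    Borel measure on S; the step integrals converge by dominated convergence.

    Haviland's theorem is obtained without Riesz-Markov: extend L to a positive
    functional Lt on all polynomially bounded functions (M. Riesz), so that
    nu A := Lt 1_A is a finitely additive set function, and regularize nu into
    an outer measure mu for which open sets are Caratheodory measurable, with
    mu U <= nu U for U open and nu K <= mu K for K closed and compact.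
    Approximating f >= 0 by the layer sums \sum_k h 1_{f > (k+1)h} turns the
    first inequality into \int f <= Lt f and the second into
    Lt (f 1_K) <= \int f; for a polynomial f, the part of Lt f outside the ball
    |x|^2 <= r is at most L (f |x|^2) / r. *)
From HB Require Import structures.
Require Import Defs.
From mathcomp Require Import all_boot all_order all_algebra.
From mathcomp Require Import all_classical all_reals all_analysis.
From mathcomp Require Import ring lra finmap measurable_realfun.
Import numFieldNormedType.Exports.

Set Implicit Arguments.
Unset Strict Implicit.
Unset Printing Implicit Defensive.

Import Order.TTheory GRing.Theory Num.Theory.

Local Open Scope classical_set_scope.
Local Open Scope ring_scope.

(** * Positive extension of functionals *)

Section riesz_extension.
Variables (T : Type) (R : realType) (S : set T).
Implicit Types (G : set ((T -> R) * R)) (f g : T -> R).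

(** A partial functional is encoded by its graph, so that extensions are ordered by plain inclusion.
    Single-valuedness follows from the two clauses: two values at one [f] differ by a value at 0,
    and positivity applies in both directions. *)
Definition positive_graph G : Prop :=
  (forall a f r g s, G (f, r) -> G (g, s) ->
     G (fun x => a * f x + g x, a * r + s)) /\
  (forall f r, G (f, r) -> (forall x, S x -> 0 <= f x) -> 0 <= r).

Definition graph_dominated G g : Prop :=
  exists q r, G (q, r) /\ forall x, S x -> `|g x| <= q x.

(** One-dimensional step of the extension. A value at [g] is admissible when it lies above the
    values of all minorants of [g] and below those of all majorants; the supremum [c] over the
    minorants does, and domination makes it finite. *)
Lemma positive_graph_extend G g : positive_graph G -> graph_dominated G g ->
  exists G' c, [/\ positive_graph G', G `<=` G' & G' (g, c)].
Proof.
move=> [Glin Gpos] [q [b [Gq gq]]].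
have G0 : G (fun=> 0, 0).
  have := Glin (- 1) _ _ _ _ Gq Gq.
  rewrite (_ : - 1 * b + b = 0); last by ring.
  by congr (G (_, _)); apply/funext => x; ring.
have Gscale a f r : G (f, r) -> G (fun x => a * f x, a * r).
  move=> Gf; have := Glin a _ _ _ _ Gf G0; rewrite addr0.
  by congr (G (_, _)); apply/funext => x; rewrite addr0.
have Gle f r f' r' : G (f, r) -> G (f', r') ->
    (forall x, S x -> f x <= f' x) -> r <= r'.
  move=> Gf Gf' ff'; rewrite -subr_ge0.
  have := Glin (- 1) _ _ _ _ Gf Gf'; move/Gpos => H.
  rewrite [leRHS](_ : _ = - 1 * r + r'); last by ring.
  by apply: H => x Sx; have := ff' x Sx; lra.
pose E := [set r | exists2 f, G (f, r) & forall x, S x -> f x <= g x].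
have Eub f r : G (f, r) -> (forall x, S x -> g x <= f x) -> ubound E r.
  move=> Gf gf s [h Gh hg]; apply: (Gle _ _ _ _ Gh Gf) => x Sx.
  exact: le_trans (hg x Sx) (gf x Sx).
have E0 : E !=set0.
  exists (- 1 * b); exists (fun x => - 1 * q x); first exact: Gscale.
  by move=> x Sx; rewrite mulN1r lerNl; apply: le_trans (gq x Sx); rewrite -normrN ler_norm.
have ubE : has_ubound E.
  exists b; apply: (Eub _ _ Gq) => x Sx.
  exact: le_trans (ler_norm _) (gq x Sx).
pose c := sup E.
exists [set fr | exists f r t, [/\ G (f, r), fr.1 = (fun x => f x + t * g x) &
  fr.2 = r + t * c]], c; split; last first.
- exists (fun=> 0), 0, 1; split=> //=; last by rewrite add0r mul1r.
  by apply/funext => x; rewrite add0r mul1r.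
- move=> [f r] Gf; exists f, r, 0; split=> //=; last by rewrite mul0r addr0.
  by apply/funext => x; rewrite mul0r addr0.
- split.
    move=> a _ _ _ _ [f [r [t [Gf /= -> ->]]]] [f' [r' [t' [Gf' /= -> ->]]]].
    exists (fun x => a * f x + f' x), (a * r + r'), (a * t + t').
    split=> /=; [exact: Glin| |by ring].
    by apply/funext => x; ring.
  move=> _ _ [f [r [t [Gf /= -> ->]]]] fg0.
  (* Dividing [f + t * g >= 0] by [|t|] makes [f / (- t)] a majorant of [g] if [t < 0], and
     [- f / t] a minorant if [t > 0]. *)
  have [t0|t0|t0] := ltgtP t 0; last by
    rewrite t0 mul0r addr0; apply: (Gpos _ _ Gf) => x /fg0; rewrite t0 mul0r addr0.
  + have tN : 0 < (- t)^-1 by rewrite invr_gt0 oppr_gt0.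
    have : c <= (- t)^-1 * r.
      apply: ge_sup => //; apply: Eub (Gscale _ _ _ Gf) _ => x /fg0 fg.
      by rewrite -ler_pdivrMl// invrK; lra.
    by rewrite -ler_pdivrMl// invrK; lra.
  + have tN : 0 < t^-1 by rewrite invr_gt0.
    have : (- t^-1) * r <= c.
      apply: ub_le_sup => //; exists (fun x => (- t^-1) * f x); first exact: Gscale.
      by move=> x /fg0 fg; rewrite mulNr lerNl -ler_pdivrMl// invrK; lra.
    by rewrite mulNr lerNl -ler_pdivrMl// invrK; lra.
Qed.

Theorem riesz_extension G : positive_graph G -> G (fun=> 0, 0) ->
  exists L : (T -> R) -> R,
    [/\ forall f r, G (f, r) -> L f = r,
        forall a f g, graph_dominated G f -> graph_dominated G g ->
          L (fun x => a * f x + g x) = a * L f + L g &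
        forall f, graph_dominated G f -> (forall x, S x -> 0 <= f x) -> 0 <= L f].
Proof.
move=> Gpg G0.
(* Zorn's lemma runs over the sets whose union with [G] is positive, so that the union of the empty
   chain qualifies too. *)
have [F FP Ftot|A [[Alin Apos] Amax]] :=
    @Zorn_bigcup _ [set H | positive_graph (H `|` G)].
  have Fdir fr gs : (\bigcup_(X in F) X `|` G) fr -> (\bigcup_(X in F) X `|` G) gs ->
      (G fr /\ G gs) \/ exists2 X, F X & (X `|` G) fr /\ (X `|` G) gs.
    move=> [[X FX Xfr]|Gfr] [[Y FY Ygs]|Ggs]; last by left.
    - right; have [XY|YX] := Ftot _ _ FX FY.
        by exists Y => //; split; left => //; exact: XY.
      by exists X => //; split; left => //; exact: YX.
    - by right; exists X => //; split; [left|right].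
    - by right; exists Y => //; split; [right|left].
  split.
    move=> a f r g s Ff Fg; have [[Gf Gg]|[X FX [Xf Xg]]] := Fdir _ _ Ff Fg.
      by right; apply: Gpg.1.
    by have [XA|XA] := (FP _ FX).1 a _ _ _ _ Xf Xg; [left; exists X|right].
  move=> f r Ff f0; have [[Gf _]|[X FX [Xf _]]] := Fdir _ _ Ff Ff.
    exact: Gpg.2 Gf f0.
  exact: (FP _ FX).2 Xf f0.
have Auniq f r s : (A `|` G) (f, r) -> (A `|` G) (f, s) -> r = s.
  have le r' s' : (A `|` G) (f, r') -> (A `|` G) (f, s') -> r' <= s'.
    move=> Gr Gs; have /Apos := Alin (- 1) _ _ _ _ Gr Gs.
    by move=> H; rewrite -subr_ge0 addrC -mulN1r; apply: H => x _; rewrite mulN1r addNr.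
  by move=> Gr Gs; apply/eqP; rewrite eq_le !le.
have Aex f : graph_dominated G f -> exists r, (A `|` G) (f, r).
  move=> [q [r [Gq fq]]].
  have [|G' [c [G'pg AG' G'f]]] := @positive_graph_extend (A `|` G) f (conj Alin Apos).
    by exists q, r; split => //; right.
  exists c; apply: contrapT => nAc; apply: (Amax G'); last first.
    by rewrite /= (_ : G' `|` G = G')//; apply: setUidl => z Gz; apply: AG'; right.
  split; first by move=> z Az; apply: AG'; left.
  by move=> /(_ _ G'f) Af; apply: nAc; left.
(* By [Aex] the default 0 is reached only at functions that are not dominated. *)
pose L f := xget 0 [set r | (A `|` G) (f, r)].
have LP f r : (A `|` G) (f, r) -> L f = r.
  by move=> Af; apply: xget_unique => // s /Auniq; apply.
have AL f : graph_dominated G f -> (A `|` G) (f, L f).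
  by move=> /Aex [r Ar]; rewrite (LP _ _ Ar).
exists L; split.
- by move=> f r Gf; apply: LP; right.
- by move=> a f g /AL Lf /AL Lg; apply: LP; exact: Alin.
- by move=> f /AL Lf f0; exact: Apos Lf f0.
Qed.

End riesz_extension.

(** * Regularization of a finitely additive set function *)

Section regularization.
Variables (T : ptopologicalType) (R : realType) (nu : set T -> R).
Hypothesis regT : regular_space T.
Hypothesis nu_ge0 : forall A, 0 <= nu A.
Hypothesis nuU : forall A B, A `&` B = set0 -> nu (A `|` B) = nu A + nu B.

(** Closedness is demanded besides compactness because [T] is regular but not assumed Hausdorff. *)
Definition inner_content (U : set T) : \bar R :=
  ereal_sup [set (nu K)%:E | K in [set K | [/\ compact K, closed K & K `<=` U]]].

Definition outer_regularization (A : set T) : \bar R :=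
  ereal_inf [set inner_content U | U in [set U | open U /\ A `<=` U]].

Local Notation lam := inner_content.
Local Notation mu := outer_regularization.

Let nu0 : nu set0 = 0.
Proof. by have := nuU (setIid set0); rewrite setUid; lra. Qed.

Let le_nu A B : A `<=` B -> nu A <= nu B.
Proof.
by move=> AB; rewrite -(setDUK AB) nuU ?setDIK// lerDl. Qed.

Let nuU_le A B : nu (A `|` B) <= nu A + nu B.
Proof.
have -> : A `|` B = A `|` (B `\` A) by rewrite setUDr setDv setD0.
by rewrite nuU ?setDIK// lerD2l le_nu//; exact: subDsetl.
Qed.

Let nu_bigU_le N (A : nat -> set T) :
  nu (\big[setU/set0]_(i < N) A i) <= \sum_(i < N) nu (A i).
Proof.
elim: N => [|N IH]; first by rewrite !big_ord0 nu0.
by rewrite !big_ord_recr/= (le_trans (nuU_le _ _))// lerD2r.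
Qed.

Let le_lam U V : U `<=` V -> (lam U <= lam V)%E.
Proof.
move=> UV; apply: ge_ereal_sup => _ [K [cK clK KU] <-].
by apply: ereal_sup_ubound; exists K => //; split=> //; exact: subset_trans UV.
Qed.

Let lam_le U : (lam U <= (nu U)%:E)%E.
Proof. by apply: ge_ereal_sup => _ [K [_ _ KU] <-]; rewrite lee_fin le_nu. Qed.

Let nu_le_lam K U : compact K -> closed K -> K `<=` U -> ((nu K)%:E <= lam U)%E.
Proof. by move=> cK clK KU; apply: ereal_sup_ubound; exists K. Qed.

Let lam_ge0 U : (0 <= lam U)%E.
Proof.
apply: (le_trans _ (nu_le_lam compact0 (@closed0 T) (@sub0set _ U))).
by rewrite lee_fin nu_ge0.
Qed.

Let lam_fin U : lam U \is a fin_num.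
Proof. by rewrite ge0_fin_numE// (le_lt_trans (lam_le U))// ltry. Qed.

Let mu_open U : open U -> mu U = lam U.
Proof.
move=> oU; apply/eqP; rewrite eq_le; apply/andP; split.
  by apply: ereal_inf_lbound; exists U => //; split.
by apply: le_ereal_inf_tmp => _ [V [_ UV] <-]; exact: le_lam.
Qed.

Let mu_ge0 A : (0 <= mu A)%E.
Proof. by apply: le_ereal_inf_tmp => _ [V _ <-]. Qed.

Let mu_le_lam A U : open U -> A `<=` U -> (mu A <= lam U)%E.
Proof. by move=> oU AU; apply: ereal_inf_lbound; exists U. Qed.

Let le_mu A B : A `<=` B -> (mu A <= mu B)%E.
Proof.
move=> AB; apply: le_ereal_inf_tmp => _ [V [oV BV] <-].
by apply: mu_le_lam => //; exact: subset_trans BV.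
Qed.

Let mu_fin A : mu A \is a fin_num.
Proof.
by rewrite ge0_fin_numE// (le_lt_trans (mu_le_lam openT (@subsetT _ A)))// ltey_eq lam_fin.
Qed.

(** A compact [K] inside the union is cut into finitely many closed pieces, each inside one [F i];
    finite subadditivity of [nu] then suffices. Regularity provides the pieces: each point of [K]
    has a neighborhood whose closure stays in some [F i]. *)
Let lam_bigcup (F : nat -> set T) : (forall i, open (F i)) ->
  (lam (\bigcup_i F i) <= \sum_(i <oo) lam (F i))%E.
Proof.
move=> oF; apply: ge_ereal_sup => _ [K [cK clK KF] <-].
have /choice[g gP] : forall x, exists iV : nat * set T, K x ->
    [/\ nbhs x iV.2 & closure iV.2 `<=` F iV.1].
  move=> x; have [Kx|] := pselect (K x); last by exists (0%N, set0).
  have [i _ Fix] := KF _ Kx.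
  have [V Vx VF] := regT (open_nbhs_nbhs (conj (oF i) Fix)).
  by exists (i, V).
have cK' := cK; rewrite compact_cover in cK'.
have [||D DK KD] := cK' T K (fun x => interior (g x).2).
- by move=> x _; exact: open_interior.
- by move=> x Kx; exists x => //; have [] := gP _ Kx.
(* The finite subcover [D] is grouped by the index [i] of the open set that contains the closure. *)
pose C i := K `&` \bigcup_(x in [set` D] `&` [set x | (g x).1 = i]) closure (g x).2.
have clC i : closed (\bigcup_(x in [set` D] `&` [set x | (g x).1 = i]) closure (g x).2).
  by apply: closed_bigcup => [|x _]; [exact: finite_setIl (finite_fset D)|exact: closed_closure].
have CF i : C i `<=` F i.
  move=> y [Ky [x [/= /DK /set_mem Kx <-]]].
  by have [_] := gP _ Kx; apply.
pose N := (\max_(x <- finmap.enum_fset D) (g x).1).+1.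
have KC : K `<=` \big[setU/set0]_(i < N) C i.
  move=> y Ky; have [x /= xD xy] := KD _ Ky.
  rewrite -bigcup_mkord; exists (g x).1 => /=.
    by rewrite ltnS; apply: (@leq_bigmax_seq _ (finmap.enum_fset D) xpredT (fun x => (g x).1)).
  by split => //; exists x => //; apply: subset_closure; exact: interior_subset xy.
apply: le_trans (nneseries_lim_ge N _) => //.
rewrite big_mkord.
apply: (@le_trans _ _ (\sum_(i < N) (nu (C i))%:E)%E).
  by rewrite sumEFin lee_fin (le_trans (le_nu KC)).
apply: lee_sum => i _; apply: nu_le_lam => //.
  exact: compact_closedI.
by apply: closedI.
Qed.

Let mu_sigma_subadditive : sigma_subadditive mu.
Proof.
move=> F; apply/lee_addgt0Pr => e e0.
apply: le_trans (epsilon_trick xpredT _ (ltW e0)) => //.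
have /choice[U UP] : forall i, exists U, [/\ open U, F i `<=` U &
    (lam U <= mu (F i) + (e / (2 ^ i.+1)%:R)%:E)%E].
  move=> i; have e0' : 0 < e / (2 ^ i.+1)%:R by rewrite divr_gt0// ltr0n expn_gt0.
  have [_ [U [oU FU] <-] /ltW ?] := lb_ereal_inf_adherent e0' (mu_fin (F i)).
  by exists U.
apply: (@le_trans _ _ (lam (\bigcup_i U i))).
  apply: mu_le_lam; first by apply: bigcup_open => i _; have [] := UP i.
  by apply: subset_bigcup => i _; have [] := UP i.
apply: le_trans (lam_bigcup _) _; first by move=> i; have [] := UP i.
by apply: lee_nneseries => // i _; have [] := UP i.
Qed.

(** [K] nearly exhausts the content of [V] inside [U], and [K'] that of the open set [V] minus [K],
    which contains the part of [V] outside [U]. Being disjoint, they add up inside [V], where [nu]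
    is additive. *)
Let mu_open_split V U : open V -> open U -> (mu (V `&` U) + mu (V `&` ~` U) <= mu V)%E.
Proof.
move=> oV oU; rewrite (mu_open oV) (mu_open (openI oV oU)).
apply/lee_addgt0Pr => e e0.
have e20 : 0 < e / 2 by rewrite divr_gt0.
have [_ [K [cK clK KVU] <-] ltK] := ub_ereal_sup_adherent e20 (lam_fin (V `&` U)).
have oVK : open (V `\` K) by rewrite setDE; apply: openI => //; exact: closed_openC.
have [_ [K' [cK' clK' K'V] <-] ltK'] := ub_ereal_sup_adherent e20 (lam_fin (V `\` K)).
have VUK : V `&` ~` U `<=` V `\` K by move=> x [Vx nUx]; split=> // /KVU[].
apply: (@le_trans _ _ (lam (V `&` U) + lam (V `\` K))%E).
  by rewrite leeD2l// mu_le_lam.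
move: ltK ltK'; rewrite -!/(lam _).
rewrite -(fineK (lam_fin (V `&` U))) -(fineK (lam_fin (V `\` K))).
rewrite -(fineK (lam_fin V)) -!EFinB -!EFinD !lte_fin !lee_fin => ltK ltK'.
have : nu (K `|` K') <= fine (lam V).
  rewrite -lee_fin (fineK (lam_fin V)); apply: nu_le_lam.
  - exact: compactU.
  - exact: closedU.
  - by move=> x [/KVU[]|/K'V[]].
rewrite nuU; first by lra.
by apply/seteqP; split=> // x [Kx /K'V[]].
Qed.

Lemma outer_regularizationP : exists m : {outer_measure set T -> \bar R},
  [/\ forall U, open U -> m.-caratheodory U,
      forall U, open U -> (m U <= (nu U)%:E)%E &
      forall K, compact K -> closed K -> ((nu K)%:E <= m K)%E].
Proof.
have mu0 : mu set0 = 0%E.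
  apply/eqP; rewrite eq_le mu_ge0 andbT mu_open; last exact: open0.
  by rewrite (le_trans (lam_le _))// nu0.
pose m : {outer_measure set T -> \bar R} :=
  HB.pack mu (isOuterMeasure.Build R T mu mu0 mu_ge0 le_mu mu_sigma_subadditive).
exists m; split.
(* A test set [X] may be replaced by an open superset [V], since [mu X] is an infimum over these. *)
- move=> U oU; apply: le_caratheodory_measurable => X.
  apply: le_ereal_inf_tmp => _ [V [oV XV] <-].
  rewrite -(mu_open oV); apply: le_trans (mu_open_split oV oU).
  by apply: leeD; apply: le_mu; exact: setSI.
- by move=> U oU; rewrite /= mu_open.
- move=> K cK clK; apply: le_ereal_inf_tmp => _ [V [oV KV] <-].
  exact: nu_le_lam.
Qed.

End regularization.

(** * Layer sums and polynomial functions *)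

Section layer_cake.
Variable R : realType.
Implicit Types (h y : R) (N : nat) (e : nat -> bool).

(** [e k] says that [y] reaches the level [h * (k + 1)]. If the last layer counts, [y] exceeds the
    height of the whole stack. Here and in the next lemma [e] may mean strict or weak comparison, so
    open and closed superlevel sets both fit. *)
Lemma layer_sum_le h N e y : 0 < h -> 0 <= y ->
  (forall k, e k -> h * k.+1%:R <= y) -> \sum_(k < N) h * (e k)%:R <= y.
Proof.
move=> h0 y0 ey; elim: N => [|N IH]; first by rewrite big_ord0.
have [eN|eN] := boolP (e N); last first.
  by rewrite big_ord_recr /= (negbTE eN) mulr0 addr0.
apply: le_trans (ey _ eN); apply: (@le_trans _ _ (\sum_(k < N.+1) h)).
  by apply: ler_sum => k _; rewrite ler_piMr ?(ltW h0)// lern1 leq_b1.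
by rewrite sumr_const card_ord mulr_natr.
Qed.

(** The sum loses at most the incomplete top layer, of height [h], once the stack is tall enough for
    [y]. *)
Lemma layer_sum_ge h N e y : 0 < h ->
  (forall k, h * k.+1%:R < y -> e k) -> y <= h * N.+1%:R ->
  y <= h + \sum_(k < N) h * (e k)%:R.
Proof.
move=> h0 ye; elim: N => [|N IH] yN; first by rewrite big_ord0 addr0 (le_trans yN)// mulr1.
have [yN'|yN'] := leP y (h * N.+1%:R).
  rewrite big_ord_recr /= addrA (le_trans (IH yN'))// lerDl.
  by rewrite mulr_ge0// ltW.
apply: le_trans yN _; rewrite (eq_bigr (fun=> h)) => [|k _].
  by rewrite sumr_const card_ord -mulrS mulr_natr.
rewrite ye ?mulr1// (le_lt_trans _ yN')// ler_wpM2l ?(ltW h0)//.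
by rewrite ler_nat ltn_ord.
Qed.

(** With mesh [1 / (j + 1)], taking [(j + 1)^2] layers gives a stack of height [j + 1], so the mesh
    shrinks while the height eventually passes [y]. *)
Lemma layer_sum_cvg (e : nat -> nat -> bool) y : 0 <= y ->
  (forall j k, j.+1%:R^-1 * k.+1%:R < y -> e j k) ->
  (forall j k, e j k -> j.+1%:R^-1 * k.+1%:R <= y) ->
  \sum_(k < j.+1 * j.+1) j.+1%:R^-1 * (e j k)%:R @[j --> \oo] --> y.
Proof.
move=> y0 ye ey; have h0 j : (0 : R) < j.+1%:R^-1 by rewrite invr_gt0.
apply: (@squeeze_cvgr _ _ _ _ (fun j => y - j.+1%:R^-1) (cst y)).
- near=> j; apply/andP; split; last by apply: layer_sum_le => //; exact: ey.
  rewrite lerBlDl; apply: layer_sum_ge => //; first exact: ye.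
  rewrite -[(j.+1 * j.+1).+1%:R]natr1 natrM mulrDr mulKf ?pnatr_eq0// mulr1.
  rewrite (@le_trans _ _ j.+1%:R)//.
    near: j; apply: (filterS _ (nbhs_infty_ger y)) => j /le_trans; apply.
    by rewrite ler_nat.
  by rewrite lerDl ltW.
- rewrite -[X in _ --> X]subr0; apply: cvgB; first exact: cvg_cst.
  exact: cvg_harmonic.
- exact: cvg_cst.
Unshelve. all: by end_near. Qed.

End layer_cake.

Section peval.
Variables (R : realType) (n : nat).
Implicit Types (p q : mpoly n R) (x : 'rV[R]_n) (S : set 'rV[R]_n).

Lemma peval_continuous p : continuous (peval p).
Proof.
have cm (m : multinom n) : continuous (fun x : 'rV[R]_n => \prod_i x ord0 i ^+ m i).
  apply: continuous_big => [z|i _ x]; first exact: cvgM cvg_fst cvg_snd.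
  apply: (@continuous_comp _ _ _ (fun x => x ord0 i) (fun y => y ^+ m i)).
    exact: coord_continuous.
  exact: exprn_continuous.
rewrite /peval; under eq_fun do rewrite mevalE.
apply: continuous_big => [z|m _ x]; first exact: cvgD cvg_fst cvg_snd.
exact: cvgM (cvg_cst _) (cm m x).
Qed.

(** The squared Euclidean norm is kept as a polynomial so that its product with a polynomial again
    lies in the domain of the original functional. *)
Definition sqnorm : mpoly n R := \sum_(i < n) mpolyX R (mnm1 i) ^+ 2.

Lemma peval_sqnorm x : peval sqnorm x = \sum_(i < n) x ord0 i ^+ 2.
Proof.
rewrite /peval rmorph_sum; apply: eq_bigr => i _.
by rewrite rmorphXn/= mevalXU.
Qed.

Lemma sqnorm_ge0 x : 0 <= peval sqnorm x.
Proof. by rewrite peval_sqnorm sumr_ge0// => i _; rewrite sqr_ge0. Qed.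

Lemma sqnorm_ball_closed (r : R) : closed [set x | peval sqnorm x <= r].
Proof.
apply: (@closed_comp _ _ _ [set y | y <= r]); last exact: closed_le.
by move=> x _; exact: peval_continuous.
Qed.

Lemma sqnorm_ball_compact (r : R) : compact [set x | peval sqnorm x <= r].
Proof.
(* The half-width avoids square roots: [r] is at most the square of [|r| + 1], for every real
   [r]. *)
have box : compact [set x : 'rV[R]_n | forall i, x ord0 i \in `[- (`|r| + 1), `|r| + 1]].
  apply: (@rV_compact _ _ (fun=> `[- (`|r| + 1), `|r| + 1]%classic)) => i.
  exact: segment_compact.
apply: (subclosed_compact (@sqnorm_ball_closed r) box) => x /= xr i.
suff : `|x ord0 i| <= `|r| + 1 by rewrite ler_norml.
rewrite -(ler_pXn2r (n := 2)) ?nnegrE ?addr_ge0// real_normK ?num_real//.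
apply: (@le_trans _ _ r).
  apply: le_trans xr; rewrite peval_sqnorm (bigD1 i)//= lerDl.
  by rewrite sumr_ge0// => j _; rewrite sqr_ge0.
by have := ler_norm r; have := normr_ge0 r; nra.
Qed.

Lemma poly_bounded_peval S p : (forall x, S x -> 0 <= peval p x) ->
  poly_bounded S (peval p).
Proof. by move=> p0; exists p => x Sx; rewrite ger0_norm ?p0. Qed.

Lemma poly_bounded_le S f g : (forall x, S x -> `|f x| <= `|g x|) ->
  poly_bounded S g -> poly_bounded S f.
Proof.
by move=> fg [q gq]; exists q => x Sx; rewrite (le_trans (fg x Sx))// gq.
Qed.

Lemma poly_bounded_lin S a f g : poly_bounded S f -> poly_bounded S g ->
  poly_bounded S (fun x => a * f x + g x).
Proof.
move=> [p fp] [q gq]; exists (`|a| *: p + q) => x Sx.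
rewrite /peval mevalD mevalZ (le_trans (ler_normD _ _))// lerD ?gq//.
by rewrite normrM ler_wpM2l// fp.
Qed.

Lemma poly_bounded_cst S (c : R) : poly_bounded S (fun=> c).
Proof. by exists (mpolyC n `|c|) => x _; rewrite /peval mevalC. Qed.

Lemma poly_bounded_indic S A : poly_bounded S (\1_A : 'rV[R]_n -> R).
Proof.
apply: poly_bounded_le (poly_bounded_cst S 1) => x _.
by rewrite indicE normr1 normr_nat lern1 leq_b1.
Qed.

End peval.

(** * Haviland's theorem *)

Section continuous_caratheodory.
Variables (R : realType) (T : ptopologicalType).
Variable m : {outer_measure set T -> \bar R}.
Hypothesis m_open : forall U, open U -> m.-caratheodory U.

Lemma continuous_caratheodory_measurable (f : T -> R) : continuous f ->
  measurable_fun [set: caratheodory_type m] (f : caratheodory_type m -> R).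
Proof.
move=> cf; apply: (measurability _ (RGenOInfty.measurableE R)) => _ [_ [a ->] <-].
rewrite setTI; apply: m_open; apply: open_comp => [x _|]; first exact: cf.
exact: interval_open.
Qed.

Lemma closed_caratheodory A : closed A -> m.-caratheodory A.
Proof.
move=> clA; rewrite -[A]setCK; apply: caratheodory_measurable_setC.
by apply: m_open; exact: closed_openC.
Qed.

End continuous_caratheodory.

Lemma ge0_integral_indic_sum d (T : measurableType d) (R : realType)
    (mu : {measure set T -> \bar R}) N (c : 'I_N -> R) (E : 'I_N -> set T) :
  (forall k, 0 <= c k) -> (forall k, measurable (E k)) ->
  (\int[mu]_x (\sum_(k < N) c k * \1_(E k) x)%:E = \sum_(k < N) (c k)%:E * mu (E k))%E.
Proof.
move=> c0 mE; under eq_integral do rewrite -sumEFin.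
rewrite ge0_integral_sum//.
- apply: eq_bigr => k _; under eq_integral do rewrite EFinM.
  rewrite ge0_integralZl//.
  + by rewrite integral_indic// setIT.
  + by apply/measurable_EFinP; exact: measurable_indic.
  + by rewrite lee_fin.
- move=> k; apply/measurable_EFinP; apply: measurable_funM => //.
- by move=> k x _; rewrite lee_fin mulr_ge0// indicE.
Qed.

Section haviland_functional.
Variables (R : realType) (n : nat) (S : set 'rV[R]_n) (L : mpoly n R -> R).
Hypothesis L_lin : forall a p q, L (a *: p + q) = a * L p + L q.
Hypothesis L_pos : forall p, (forall x, S x -> 0 <= peval p x) -> 0 <= L p.

Lemma positive_extension : exists Lt : ('rV[R]_n -> R) -> R,
  [/\ forall p, Lt (peval p) = L p,
      forall a f g, poly_bounded S f -> poly_bounded S g ->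
        Lt (fun x => a * f x + g x) = a * Lt f + Lt g &
      forall f, poly_bounded S f -> (forall x, S x -> 0 <= f x) -> 0 <= Lt f].
Proof.
(* A relation indexed by polynomials: that [L p] depends only on the function [peval p] is left to
   positivity. *)
pose G : set (('rV[R]_n -> R) * R) := range (fun p => (peval p, L p)).
have Gpg : positive_graph S G.
  split=> [a _ _ _ _ [p _ [<- <-]] [q _ [<- <-]]|_ _ [p _ [<- <-]]]; last exact: L_pos.
  exists (a *: p + q) => //; rewrite L_lin; congr (_, _).
  by apply/funext => x; rewrite /peval mevalD mevalZ.
have G0 : G (fun=> 0, 0).
  exists 0 => //; congr (_, _); first by apply/funext => x; rewrite /peval meval0.
  by have := L_lin (-1) 0 0; rewrite scaler0 addr0 mulN1r addNr.
have GD f : poly_bounded S f -> graph_dominated S G f.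
  by move=> [q fq]; exists (peval q), (L q); split => //; exists q.
have [Lt [LtL Ltlin Ltpos]] := riesz_extension Gpg G0.
exists Lt; split.
- by move=> p; apply: LtL; exists p.
- by move=> a f g /GD Df /GD Dg; exact: Ltlin.
- by move=> f /GD Df; exact: Ltpos.
Qed.

End haviland_functional.

Section haviland.
Variables (R : realType) (n : nat) (S : set 'rV[R]_n) (hS : closed S).
Variable Lt : ('rV[R]_n -> R) -> R.
Hypothesis Lt_lin : forall a f g, poly_bounded S f -> poly_bounded S g ->
  Lt (fun x => a * f x + g x) = a * Lt f + Lt g.
Hypothesis Lt_pos : forall f, poly_bounded S f -> (forall x, S x -> 0 <= f x) -> 0 <= Lt f.
Implicit Types f g : 'rV[R]_n -> R.

Let nu (A : set 'rV[R]_n) : R := Lt \1_A.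

Let Lt_le f g : poly_bounded S f -> poly_bounded S g ->
  (forall x, S x -> f x <= g x) -> Lt f <= Lt g.
Proof.
move=> Bf Bg fg; rewrite -subr_ge0 addrC -mulN1r -Lt_lin//.
apply: Lt_pos => [|x Sx]; first exact: poly_bounded_lin.
by rewrite mulN1r addrC subr_ge0 fg.
Qed.

Let Lt0 : Lt (fun=> 0) = 0.
Proof.
have B0 := @poly_bounded_cst R n S 0.
by have := Lt_lin (- 1) B0 B0; rewrite mulr0 addr0; lra.
Qed.

Lemma functional_indicU (A B : set 'rV[R]_n) : A `&` B = set0 ->
  Lt \1_(A `|` B) = Lt \1_A + Lt \1_B.
Proof.
move=> AB; rewrite -[Lt \1_A]mul1r -Lt_lin; [|exact: poly_bounded_indic..].
congr Lt; apply/funext => x; rewrite mul1r !indicE in_setU.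
have [xA|] := boolP (x \in A); have [xB|] := boolP (x \in B) => //=; rewrite ?addr0 ?add0r//.
by have : (A `&` B) x; [split; exact: set_mem|rewrite AB].
Qed.

Let Lt_sum N h (E : nat -> set 'rV[R]_n) :
  poly_bounded S (fun x => \sum_(k < N) h * \1_(E k) x) /\
  Lt (fun x => \sum_(k < N) h * \1_(E k) x) = \sum_(k < N) h * nu (E k).
Proof.
elim: N => [|N [IB IL]].
  rewrite big_ord0 (_ : (fun _ => _) = fun=> 0).
    by split; [exact: poly_bounded_cst|exact: Lt0].
  by apply/funext => x; rewrite big_ord0.
rewrite big_ord_recr/= -IL addrC -Lt_lin//; last exact: poly_bounded_indic.
have <- : (fun x => h * \1_(E N) x + \sum_(k < N) h * \1_(E k) x) =
          (fun x => \sum_(k < N.+1) h * \1_(E k) x).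
  by apply/funext => x; rewrite big_ord_recr/= addrC.
by split=> //; apply: poly_bounded_lin => //; exact: poly_bounded_indic.
Qed.

Variable m : {outer_measure set 'rV[R]_n -> \bar R}.
Hypothesis m_open : forall U, open U -> m.-caratheodory U.
Hypothesis m_le_nu : forall U, open U -> (m U <= (Lt \1_U)%:E)%E.
Hypothesis nu_le_m : forall K, compact K -> closed K -> ((Lt \1_K)%:E <= m K)%E.

Let M : {measure set (caratheodory_type m) -> \bar R} := m.

Let meas f : continuous f ->
  measurable_fun [set: caratheodory_type m] (f : caratheodory_type m -> R).
Proof. exact: continuous_caratheodory_measurable. Qed.

(** The complement of [S] is open, and its indicator vanishes on [S], the only place where
    positivity looks. *)
Lemma regularization_supported : m (~` S) = 0%E.
Proof.
apply/eqP; rewrite eq_le outer_measure_ge0 andbT.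
apply: le_trans (m_le_nu (closed_openC hS)) _; rewrite lee_fin -Lt0.
apply: Lt_le => [||x Sx]; [exact: poly_bounded_indic|exact: poly_bounded_cst|].
by rewrite indicE memNset.
Qed.

(** Strict superlevel sets are open, so [m_le_nu] bounds every layer sum. The sums for different
    meshes are not monotone in [j], hence Fatou's lemma for the limit. *)
Lemma integral_le_functional f : continuous f -> (forall x, 0 <= f x) ->
  poly_bounded S f -> (\int[M]_x (f x)%:E <= (Lt f)%:E)%E.
Proof.
move=> cf f0 Bf.
pose h j : R := j.+1%:R^-1.
pose E j k : set 'rV[R]_n := [set x | h j * k.+1%:R < f x].
have h0 j : 0 < h j by rewrite invr_gt0.
have oE j k : open (E j k).
  by apply: (@open_comp _ _ f [set y | h j * k.+1%:R < y]) => [x _|]; [exact: cf|exact: open_gt].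
pose s j x : R := \sum_(k < j.+1 * j.+1) h j * \1_(E j k) x.
have mE j k : measurable (E j k : set (caratheodory_type m)) by exact: m_open.
have s0 j x : 0 <= s j x by apply: sumr_ge0 => k _; rewrite mulr_ge0 ?indicE// ltW.
have sf x : s j x @[j --> \oo] --> f x.
  apply: (@layer_sum_cvg R (fun j k => x \in E j k)) => // j k.
    by move=> ?; exact/mem_set.
  by move=> /set_mem /ltW.
have Is j : (\int[M]_x (s j x)%:E <= (Lt f)%:E)%E.
  rewrite ge0_integral_indic_sum//; last by move=> _; exact: ltW.
  have [Bs Ls] := Lt_sum (j.+1 * j.+1) (h j) (E j).
  apply: (@le_trans _ _ (Lt (s j))%:E).
    rewrite Ls -sumEFin; apply: lee_sum => k _; rewrite EFinM.
    by rewrite lee_pmul2l ?lte_fin// m_le_nu.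
  rewrite lee_fin; apply: Lt_le => // x _.
  by apply: (@layer_sum_le R (h j) _ (fun k => x \in E j k)) => // k /set_mem /ltW.
have ms j : measurable_fun [set: caratheodory_type m] (s j : caratheodory_type m -> R).
  apply: measurable_sum => k; apply: measurable_funM => //.
have -> : (\int[M]_x (f x)%:E = \int[M]_x limn_einf (fun j => (s j x)%:E))%E.
  apply: eq_integral => x _.
  have sfE : (s j x)%:E @[j --> \oo] --> (f x)%:E by apply: cvg_EFin; [exact: nearW|exact: sf].
  by have [-> _] := cvg_limn_einf_sup sfE.
apply: le_trans (@fatou _ _ _ M _ measurableT (fun j x => (s j x)%:E) _ _) _.
- by move=> j; apply/measurable_EFinP; exact: ms.
- by move=> j x _; rewrite lee_fin.
rewrite limn_einf_lim; apply: lime_le; first exact: is_cvg_einfs.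
near=> j; apply: le_trans (Is j).
by apply: ereal_inf_lbound; exists j => /=.
Unshelve. all: by end_near. Qed.

(** [f] is bounded on [K], so one finite stack of layers comes within [h] of it there. Weak
    superlevel sets cut with [K] are closed and compact, as [nu_le_m] requires. *)
Lemma functional_restrict_le_integral f K : continuous f -> (forall x, 0 <= f x) ->
  poly_bounded S f -> compact K -> closed K ->
  ((Lt (fun x => f x * \1_K x))%:E <= \int[M]_x (f x)%:E)%E.
Proof.
move=> cf f0 Bf cK clK; apply/lee_addgt0Pr => e e0.
have [B B0 fB] : exists2 B, 0 <= B & forall x, K x -> f x <= B.
  have : compact (f @` K) by apply: continuous_compact => //; exact: continuous_subspaceT.
  move=> /(@compact_bounded R R^o) [B [_ HB]]; exists (`|B| + 1); first by rewrite addr_ge0.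
  move=> x Kx; apply: le_trans (ler_norm _) _; apply: HB; last by exists x.
  by rewrite (le_lt_trans (ler_norm B))// ltrDl.
pose c := Lt (fun=> 1).
have c0 : 0 <= c by apply: Lt_pos => //; exact: poly_bounded_cst.
(* The lost top layer costs [h * c], which this mesh keeps below [e]; the added 1 covers [c = 0]. *)
pose h := e / (c + 1).
have h0 : 0 < h by rewrite divr_gt0// ltr_wpDl.
have [N BN] : exists N, B <= h * N.+1%:R.
  exists (Num.truncn (B / h)).
  by rewrite mulrC -ler_pdivrMr// ltW// truncnS_gt.
pose E k : set 'rV[R]_n := [set x | h * k.+1%:R <= f x] `&` K.
have clE' k : closed [set x | h * k.+1%:R <= f x].
  apply: (@closed_comp _ _ f [set y | h * k.+1%:R <= y]) => [x _|]; first exact: cf.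
  exact: closed_ge.
have clE k : closed (E k) by exact: closedI.
have cE k : compact (E k) by rewrite /E setIC; exact: compact_closedI.
have mE k : measurable (E k : set (caratheodory_type m)) by exact: closed_caratheodory.
have [Bs Ls] := Lt_sum N h E.
have B1 := poly_bounded_cst S (1 : R).
apply: (@le_trans _ _ (Lt (fun x => h * 1 + \sum_(k < N) h * \1_(E k) x))%:E).
  rewrite lee_fin; apply: Lt_le.
  - apply: poly_bounded_le Bf => x _.
    by rewrite normrM ler_piMr// indicE normr_nat lern1 leq_b1.
  - exact: poly_bounded_lin.
  - move=> x _; rewrite mulr1; apply: (@layer_sum_ge R h N (fun k => x \in E k)) => //.
    + move=> k; rewrite indicE; have [xK|xK] := boolP (x \in K).
        by rewrite mulr1 => /ltW fx; apply/mem_set; split=> //; exact: set_mem.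
      by rewrite mulr0 ltNge mulr_ge0// ltW.
    + rewrite indicE; have [xK|xK] := boolP (x \in K).
        by rewrite mulr1 (le_trans (fB _ _))//; exact: set_mem.
      by rewrite mulr0 (le_trans B0).
rewrite Lt_lin// Ls -/c EFinD addeC leeD//; last first.
  by rewrite lee_fin /h mulrAC ler_pdivrMr ?ltr_wpDl// ler_pM2l// lerDl.
apply: (@le_trans _ _ (\int[M]_x (\sum_(k < N) h * \1_(E k) x)%:E)%E).
  rewrite ge0_integral_indic_sum//; last by move=> _; exact: ltW.
  rewrite -sumEFin; apply: lee_sum => k _; rewrite EFinM.
  by rewrite lee_pmul2l ?lte_fin// nu_le_m.
apply: ge0_le_integral => //.
- by move=> x _; rewrite lee_fin sumr_ge0// => k _; rewrite mulr_ge0 ?indicE// ltW.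
- apply/measurable_EFinP; apply: measurable_sum => k; apply: measurable_funM => //.
- by apply/measurable_EFinP; exact: meas.
- move=> x _; rewrite lee_fin.
  by apply: (@layer_sum_le R h _ (fun k => x \in E k)) => // k /set_mem[].
Qed.

(* Outside the ball where [sqnorm <= r], [f <= f * sqnorm / r]; the functional
   of the right-hand side tends to 0, so no mass escapes to infinity. *)
Lemma functional_le_integral p : (forall x, 0 <= peval p x) ->
  ((Lt (peval p))%:E <= \int[M]_x (peval p x)%:E)%E.
Proof.
move=> p0; apply/lee_addgt0Pr => e e0.
have pq0 x : 0 <= peval (p * sqnorm R n) x.
  by rewrite /peval mevalM mulr_ge0//; [exact: p0|exact: sqnorm_ge0].
have Bp : poly_bounded S (peval p) by apply: poly_bounded_peval => x _.
have Bpq : poly_bounded S (peval (p * sqnorm R n)) by apply: poly_bounded_peval => x _.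
pose c := Lt (peval (p * sqnorm R n)).
have c0 : 0 <= c by exact: Lt_pos.
(* Chosen so that the part outside the ball, at most [c / r], is below [e]. *)
pose r := (c + 1) / e.
have r0 : 0 < r by rewrite divr_gt0// ltr_wpDl.
pose K : set 'rV[R]_n := [set x | peval (sqnorm R n) x <= r].
have BpK : poly_bounded S (fun x => peval p x * \1_K x).
  apply: poly_bounded_le Bp => x _.
  by rewrite normrM ler_piMr// indicE normr_nat lern1 leq_b1.
apply: (@le_trans _ _ (Lt (fun x => r^-1 * peval (p * sqnorm R n) x + peval p x * \1_K x))%:E).
  rewrite lee_fin; apply: Lt_le => //; first exact: poly_bounded_lin.
  move=> x _; rewrite indicE; have [xK|xK] := boolP (x \in K).
    by rewrite mulr1 lerDr mulr_ge0// invr_ge0 ltW.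
  rewrite mulr0 addr0 ler_pdivlMl// mulrC /peval mevalM ler_wpM2l//; first exact: p0.
  by rewrite leNgt; apply: contra xK => /ltW xr; exact/mem_set.
rewrite Lt_lin// -/c EFinD addeC leeD//.
  apply: functional_restrict_le_integral => //.
  - exact: peval_continuous.
  - exact: sqnorm_ball_compact.
  - exact: sqnorm_ball_closed.
by rewrite lee_fin ler_pdivrMl// /r mulrAC -mulrA divff ?gt_eqF// mulr1 lerDl.
Qed.

Lemma regularization_integral p :
  M.-integrable setT (EFin \o peval p) /\
  (\int[M]_x (peval p x)%:E = (Lt (peval p))%:E)%E.
Proof.
have pos q : (forall x, 0 <= peval q x) ->
    M.-integrable setT (EFin \o peval q) /\
    (\int[M]_x (peval q x)%:E = (Lt (peval q))%:E)%E.
  move=> q0; have cq := @peval_continuous R n q.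
  have eq : (\int[M]_x (peval q x)%:E = (Lt (peval q))%:E)%E.
    apply/eqP; rewrite eq_le functional_le_integral// integral_le_functional//.
    exact: poly_bounded_peval.
  split=> //; apply/integrableP; split; first by apply/measurable_EFinP; exact: meas.
  by under eq_integral do rewrite /= ger0_norm//; rewrite eq ltry.
(* Every polynomial is a difference of two that are nonnegative on the whole space,
   [p = q1 - q2]. *)
pose q1 := p * p + p + 1; pose q2 := p * p + 1 : mpoly n R.
have e1 x : peval q1 x = peval p x * peval p x + peval p x + 1.
  by rewrite /peval !mevalD mevalM meval1.
have e2 x : peval q2 x = peval p x * peval p x + 1.
  by rewrite /peval !mevalD mevalM meval1.
have q10 x : 0 <= peval q1 x by rewrite e1; nra.
have q20 x : 0 <= peval q2 x by rewrite e2; nra.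
have [i1 I1] := pos _ q10; have [i2 I2] := pos _ q20.
have pE : peval p = (fun x => - 1 * peval q2 x + peval q1 x).
  by apply/funext => x; rewrite e1 e2; ring.
have pE' : peval p = peval q1 \- peval q2.
  by apply/funext => x; rewrite /= e1 e2; ring.
split.
  rewrite (_ : EFin \o peval p = (EFin \o peval q1) \- (EFin \o peval q2))%E.
    exact: integrableB.
  by apply/funext => x; rewrite /= pE'.
rewrite pE' integralB_EFin// I1 I2 -pE' pE Lt_lin; try exact: poly_bounded_peval.
by rewrite mulN1r addrC.
Qed.

End haviland.

(** The representing measure lives on the Caratheodory sets of [m], among them all open sets; a null
    complement expresses that it is carried by [S]. *)
Theorem haviland (R : realType) (n : nat) (S : set 'rV[R]_n) (L : mpoly n R -> R) :
  closed S ->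
  (forall a p q, L (a *: p + q) = a * L p + L q) ->
  (forall p, (forall x, S x -> 0 <= peval p x) -> 0 <= L p) ->
  exists m : {outer_measure set 'rV[R]_n -> \bar R},
    let M : {measure set (caratheodory_type m) -> \bar R} := m in
    [/\ forall U, open U -> m.-caratheodory U, m (~` S) = 0%E &
      forall p, M.-integrable setT (EFin \o peval p) /\
        (\int[M]_x (peval p x)%:E = (L p)%:E)%E].
Proof.
move=> clS Llin Lpos.
have [Lt [LtL Ltlin Ltpos]] := positive_extension Llin Lpos.
have [] := @outer_regularizationP _ R (fun A : set 'rV[R]_n => Lt \1_A) (@uniform_regular _).
- by move=> A; apply: Ltpos => [|x _]; [exact: poly_bounded_indic|rewrite indicE].
- move=> A B AB; exact: functional_indicU Ltlin _ _ AB.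
move=> m [m_open m_le m_ge]; exists m => M; split=> //.
- exact: regularization_supported m_le.
- by move=> p; rewrite -LtL; exact: (regularization_integral Ltlin Ltpos).
Qed.

(** * Borel sets and step functions *)

Section borel_steps.
Variables (R : realType) (n : nat) (S : set 'rV[R]_n).

Lemma borel_subset A : borel S A -> A `<=` S.
Proof.
apply: (@smallest_sub _ _ _ [set B | B `<=` S]) => [|_ [U _ <-]]; last exact: subIsetr.
split=> [|A' _|F FS]; [exact: sub0set|exact: subDsetl|by move=> x [i _ /FS]].
Qed.

Lemma borel_caratheodory (m : {outer_measure set 'rV[R]_n -> \bar R}) :
  closed S -> (forall U, open U -> m.-caratheodory U) ->
  forall A, borel S A -> m.-caratheodory A.
Proof.
move=> clS m_open A; have mS := closed_caratheodory m_open clS.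
apply: (@smallest_sub _ _ _ m.-caratheodory) => [|_ [U oU <-]]; last first.
  by apply: caratheodory_measurable_setI => //; exact: m_open.
split=> [|B mB|F mF].
- exact: caratheodory_measurable_set0.
- exact: caratheodory_measurable_setD.
- exact: caratheodory_measurable_bigcup.
Qed.

Lemma borel_open U : open U -> borel S (U `&` S).
Proof. by move=> oU; apply: sub_sigma_algebra; exists U. Qed.

Lemma borelD A B : borel S A -> borel S B -> borel S (A `\` B).
Proof.
have [_ bC bU] := @smallest_sigma_algebra _ S [set U `&` S | U in open].
move=> bA bB; have -> : A `\` B = S `\` \bigcup_i bigcup2 (S `\` A) B i.
  rewrite bigcup2E; apply/seteqP; split=> x.
    by move=> [Ax nBx]; split; [exact: borel_subset bA _ Ax|move=> [[]|]].
  move=> [Sx nx]; split; last by move=> Bx; apply: nx; right.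
  by apply: contrapT => nAx; apply: nx; left.
apply: (bC); apply: bU => -[|[|i]] /=; [exact: bC|exact: bB|exact: sigma_algebra0].
Qed.

Lemma borel_preimage_itvco (f : 'rV[R]_n -> R) (a b : R) : continuous f ->
  borel S [set x | S x /\ a <= f x < b].
Proof.
move=> cf; have opre c : open [set x | f x < c].
  by apply: (@open_comp _ _ f [set y | y < c]) => [x _|]; [exact: cf|exact: open_lt].
have -> : [set x | S x /\ a <= f x < b] =
    ([set x | f x < b] `&` S) `\` ([set x | f x < a] `&` S).
  apply/seteqP; split=> x /=.
    by move=> [Sx /andP[afx fxb]]; split=> // -[]; rewrite ltNge afx.
  by move=> [[fxb Sx] nfxa]; split=> //; rewrite fxb andbT leNgt; apply/negP => ?; exact: nfxa.
by apply: borelD; exact: borel_open.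
Qed.

Lemma step_funE (s : step S) (i : 'I_(step_size s)) x :
  step_set i x -> step_fun s x = step_coef i.
Proof.
move=> six; rewrite /step_fun (bigD1 i)//= indicE mem_set// mulr1 big1 ?addr0// => j ji.
rewrite indicE memNset ?mulr0// => sjx; move/eqP: ji; apply.
by apply: (@step_disjoint _ _ _ s j i) => //; exists x.
Qed.

Lemma step_fun_notin (s : step S) x :
  (forall i : 'I_(step_size s), ~ step_set i x) -> step_fun s x = 0.
Proof. by move=> nsx; rewrite /step_fun big1// => j _; rewrite indicE memNset ?mulr0. Qed.

(** [f] is rounded down to a multiple of [1 / (j + 1)], and to 0 where [f >= j + 1]. The sets are
    level bands instead of nested superlevel sets because a [step] needs disjoint ones. *)
Lemma step_approximation (f : 'rV[R]_n -> R) : continuous f ->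
  (forall x, S x -> 0 <= f x) ->
  exists s : nat -> step S,
    [/\ forall j (i : 'I_(step_size (s j))), 0 <= step_coef i,
        forall j x, S x -> 0 <= step_fun (s j) x <= f x &
        forall x, S x -> step_fun (s j) x @[j --> \oo] --> f x].
Proof.
move=> cf f0.
pose A j (k : 'I_(j.+1 * j.+1)) : set 'rV[R]_n :=
  [set x | S x /\ k%:R / j.+1%:R <= f x < k.+1%:R / j.+1%:R].
have bA j k : borel S (@A j k) by exact: borel_preimage_itvco.
have tA j : trivIset setT (@A j).
  move=> k l _ _ [x [[_ /andP[kx xk]] [_ /andP[lx xl]]]].
  have /(le_lt_trans kx) := xl; have /(le_lt_trans lx) := xk.
  rewrite !ltr_pM2r ?invr_gt0// !ltr_nat !ltnS => lk kl.
  by apply/val_inj/eqP; rewrite eqn_leq lk kl.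
pose s j := Step (fun k : 'I_(j.+1 * j.+1) => k%:R / j.+1%:R) (@bA j) (@tA j).
have s_le j x : S x -> 0 <= step_fun (s j) x <= f x.
  move=> Sx; have [[k kx]|nx] := pselect (exists k : 'I_(step_size (s j)), step_set k x).
    by rewrite (step_funE kx); case: kx => _ /andP[-> _]; rewrite divr_ge0.
  by rewrite step_fun_notin ?lexx ?f0// => k kx; apply: nx; exists k.
exists s; split=> [j i|//|x Sx]; first by rewrite divr_ge0.
apply: (@squeeze_cvgr _ _ _ _ (fun j => f x - j.+1%:R^-1) (cst (f x))).
- near=> j; have /andP[_ ->] := s_le j _ Sx; rewrite andbT.
  have fj : f x < j.+1%:R.
    near: j; apply: (filterS _ (nbhs_infty_ger (f x))) => j /le_lt_trans; apply.
    by rewrite ltr_nat.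
  (* The band containing [x] has index the integer part of [f x * (j + 1)], which is in range since
     [f x < j + 1]. *)
  have /truncn_itv/andP[kl ku] : 0 <= f x * j.+1%:R by rewrite mulr_ge0// f0.
  have kN : (Num.truncn (f x * j.+1%:R) < j.+1 * j.+1)%N.
    rewrite -(ltr_nat R) (le_lt_trans kl)// natrM ltr_pM2r//.
  have kx : @step_set _ _ _ (s j) (Ordinal kN) x.
    by split=> //=; rewrite ler_pdivrMr// ltr_pdivlMr// kl ku.
  rewrite (step_funE kx)/= lerBlDr -[X in _ <= _ + X]mul1r -mulrDl natr1.
  by rewrite ler_pdivlMr// ltW.
- rewrite -[X in _ --> X]subr0; apply: cvgB; first exact: cvg_cst.
  exact: cvg_harmonic.
- exact: cvg_cst.
Unshelve. all: by end_near. Qed.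

End borel_steps.

(** * The two implications *)

Lemma represents_nonneg_preserving (R : realType) (n : nat) (S : set 'rV[R]_n)
    (m : set 'rV[R]_n -> 'rV[R]_n -> R) (Phi : mpoly n R -> mpoly n R) :
  (forall A x, borel S A -> S x -> 0 <= m A x) -> represents S m Phi ->
  nonneg_preserving S Phi.
Proof.
move=> m0 mPhi p p0 x Sx.
have [s [c0 sp scvg]] := step_approximation (@peval_continuous R n p) p0.
have bs : exists q, forall j x, S x -> `|step_fun (s j) x| <= peval q x.
  by exists p => j y /(sp j)/andP[s0 sle]; rewrite ger0_norm.
apply: (cvgr_to_ge (mPhi p s bs scvg x Sx)); apply: nearW => j.
by apply: sumr_ge0 => i _; rewrite mulr_ge0// m0//; exact: step_borel.
Qed.

Section step_integrals.
Variables (R : realType) (n : nat) (S : set 'rV[R]_n) (hS : closed S).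
Variable m : {outer_measure set 'rV[R]_n -> \bar R}.
Hypothesis m_open : forall U, open U -> m.-caratheodory U.
Hypothesis m_fin : (m setT < +oo)%E.

Let M : {measure set (caratheodory_type m) -> \bar R} := m.

Let mS : measurable (S : set (caratheodory_type m)).
Proof. exact: closed_caratheodory. Qed.

Let mB A : borel S A -> measurable (A : set (caratheodory_type m)).
Proof. exact: borel_caratheodory. Qed.

Lemma outer_measure_fin A : m A \is a fin_num.
Proof.
rewrite ge0_fin_numE ?outer_measure_ge0// (le_lt_trans _ m_fin)//.
exact: le_outer_measure.
Qed.

Lemma measurable_step_fun (s : step S) :
  measurable_fun (S : set (caratheodory_type m)) (step_fun s : caratheodory_type m -> R).
Proof.
apply: measurable_sum => i; apply: measurable_funM => //.
by apply: measurable_indic; exact: (mB (step_borel i)).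
Qed.

(** Turns the finite sum defining a step integral into a Lebesgue integral, to which dominated
    convergence applies. *)
Lemma integral_step_fun (s : step S) :
  (\int[M]_(x in S) (step_fun s x)%:E =
   (\sum_(i < step_size s) step_coef i * fine (m (step_set i)))%:E)%E.
Proof.
pose E (i : 'I_(step_size s)) : set (caratheodory_type m) := step_set i.
have mE i : measurable (E i) by exact: (mB (step_borel i)).
have int1 i : M.-integrable S (fun x => (\1_(E i) x)%:E).
  apply/integrableP; split; first by apply/measurable_EFinP; exact: measurable_indic.
  rewrite (eq_integral (fun x => (\1_(E i) x)%:E)).
    by rewrite integral_indic// ltey_eq outer_measure_fin.
  by move=> x _; rewrite gee0_abs// lee_fin indicE.
transitivity (\int[M]_(x in S) (\sum_(i < step_size s) (step_coef i)%:E * (\1_(E i) x)%:E))%E.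
  by apply: eq_integral => x _; rewrite /step_fun -sumEFin.
rewrite integral_sum//; last by move=> i; exact: integrableZl.
rewrite -sumEFin; apply: eq_bigr => i _.
rewrite integralZl// integral_indic// EFinM fineK ?outer_measure_fin//.
by rewrite setIidl//; apply: borel_subset; exact: step_borel.
Qed.

End step_integrals.

Lemma nonneg_preserving_represents (R : realType) (n : nat) (S : set 'rV[R]_n)
    (Phi : {linear mpoly n R -> mpoly n R}%R) :
  closed S -> nonneg_preserving S Phi ->
  exists m : set 'rV[R]_n -> 'rV[R]_n -> R,
    [/\ function_measure S m, forall A x, borel S A -> S x -> 0 <= m A x
      & represents S m Phi].
Proof.
move=> clS Phi0.
(* The factor [\1_S x] makes the functional zero for [x] outside [S], so that Haviland's theorem,
   and then choice, apply to every [x]. *)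
have /choice[m mP] x : exists m : {outer_measure set 'rV[R]_n -> \bar R},
    let M : {measure set (caratheodory_type m) -> \bar R} := m in
    [/\ forall U, open U -> m.-caratheodory U, m (~` S) = 0%E &
      forall p, M.-integrable setT (EFin \o peval p) /\
        (\int[M]_y (peval p y)%:E = (\1_S x * peval (Phi p) x)%:E)%E].
  apply: (@haviland R n S (fun p => \1_S x * peval (Phi p) x)) => //.
    by move=> a p q; rewrite linearP /peval mevalD mevalZ; ring.
  move=> p p0; rewrite indicE; have [xS|] := boolP (x \in S); last by rewrite mul0r.
  by rewrite mul1r; apply: Phi0 => //; exact: set_mem.
(* The total mass is the integral of the polynomial 1. It makes each measure finite and gives
   [Phi 1] as a common polynomial bound for all values of the function-valued measure. *)
have mT x : m x setT = (\1_S x * peval (Phi 1) x)%:E.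
  have [_ _ /(_ 1)[_ <-]] := mP x.
  under eq_integral do rewrite /peval meval1.
  by rewrite integral_cst// mul1e.
have mfin x : (m x setT < +oo)%E by rewrite mT ltry.
have mB x A : borel S A -> (m x).-caratheodory A.
  by have [mo _ _] := mP x; exact: borel_caratheodory.
exists (fun A x => fine (m x A)); split.
- split.
  + move=> A bA; exists (Phi 1) => x Sx.
    rewrite ger0_norm ?fine_ge0 ?outer_measure_ge0//.
    rewrite -lee_fin fineK ?outer_measure_fin// -[peval _ _]mul1r.
    have -> : 1 = \1_S x :> R by rewrite indicE mem_set.
    by rewrite -mT; exact: le_outer_measure.
  + by move=> x _; rewrite outer_measure0.
  + move=> A bA tA x Sx.
    have bcup : borel S (\bigcup_i A i).
      have [_ _] := @smallest_sigma_algebra _ S [set U `&` S | U in open].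
      by apply.
    have : (\sum_(0 <= i < k) m x (A i))%E @[k --> \oo] --> (fine (m x (\bigcup_i A i)))%:E.
      rewrite fineK ?outer_measure_fin//.
      exact: (@measure_semi_sigma_additive _ _ _
        (m x : {measure set (caratheodory_type (m x)) -> \bar R})
        A (fun i => mB x _ (bA i)) tA (mB x _ bcup)).
    move=> /fine_cvg.
    apply: cvg_trans; apply: near_eq_cvg; apply: nearW => k /=.
    by rewrite sum_fine// => i _; exact: outer_measure_fin.
- by move=> A x _ _; rewrite fine_ge0// outer_measure_ge0.
- move=> p s [q sq] scvg x Sx.
  have [mo mS0 Ip] := mP x.
  pose M : {measure set (caratheodory_type (m x)) -> \bar R} := m x.
  have mS : measurable (S : set (caratheodory_type (m x))) by exact: closed_caratheodory.
  have [ip Lp] := Ip p; have [iq _] := Ip q.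
  have sub (r : mpoly n R) : M.-integrable setT (EFin \o peval r) ->
      M.-integrable S (EFin \o peval r) by exact: integrableS.
  have mst j : measurable_fun (S : set (caratheodory_type (m x)))
      (fun y => (step_fun (s j) y)%:E).
    by apply/measurable_EFinP; exact: (measurable_step_fun clS mo).
  have cvgE : {ae M, forall y, S y ->
      (step_fun (s j) y)%:E @[j --> \oo] --> (EFin \o peval p) y}.
    by apply: aeW => y Sy; apply: cvg_EFin; [exact: nearW|exact: scvg].
  have domE : {ae M, forall y j, S y ->
      (`|(step_fun (s j) y)%:E| <= (EFin \o peval q) y)%E}.
    by apply: aeW => y j Sy; rewrite lee_fin; exact: sq.
  (* The polynomial bound [q] on the step functions is the dominating function; it is integrable
     because every polynomial is. *)
  have [_ _] := dominated_convergence mS mst (measurable_int _ (sub _ ip)) cvgE (sub _ iq) domE.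
  have -> : (\int[M]_(y in S) (EFin \o peval p) y)%E = (peval (Phi p) x)%:E.
    rewrite -[peval _ _]mul1r; have -> : 1 = \1_S x :> R by rewrite indicE mem_set.
    (* The complement of [S] is null, so integrating over [S] or over the whole space is the
       same. *)
    rewrite -Lp (@negligible_integral _ _ _ M setT (~` S))//; last exact: measurableC.
    by rewrite setTD setCK.
  move=> /fine_cvg; apply: cvg_trans; apply: near_eq_cvg; apply: nearW => j /=.
  by rewrite integral_step_fun.
Qed.

Theorem theorem5p2 (R : realType) (n : nat) (S : set 'rV[R]_n)
    (hS : closed S) (Phi : {linear mpoly n R -> mpoly n R}%R) :
  nonneg_preserving S Phi <->
  exists m : set 'rV[R]_n -> 'rV[R]_n -> R,
    [/\ function_measure S m,
        forall A x, borel S A -> S x -> (0 <= m A x)%R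
      & represents S m Phi].
Proof.
split; first exact: nonneg_preserving_represents.
by move=> [m [_ m0 mPhi]]; exact: represents_nonneg_preserving mPhi.
Qed.
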